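(* Let $\{X_n\}_{n\ge0}$ be a Markov chain on a state space $\mathcal{X}$ with stationary distribution $\pi$ which is polynomially ergodic of order $m>\frac12$. Let $f:\mathcal{X}\to\mathbb{R}$ be measurable and suppose that for some $D\in[0,\infty)$ we have $|f(x)|\le D$ for all $x\in\mathcal{X}$. Let $e_n=\frac1n\sum_{i=1}^n f(X_i)$, $\pi(f)=\int_{\mathcal X} f\,d\pi$, and $\mathbf{Bias}(e_n)=E(e_n)-\pi(f)$. Then for any fixed initial state $X_0=x\in\mathcal{X}$, the absolute bias $|\mathbf{Bias}(e_n)|$ is $o(n^{-1/2})$ as $n\to\infty$, i.e. $$\lim_{n\to\infty} n^{1/2}\,|\mathbf{Bias}(e_n)|=0.$$
   Context: $\mathcal{X}$ is a general measurable state space and the chain is time-homogeneous with $n$-step transition kernels $P^n(x,\cdot)$. $\|\mu-\nu\|=\sup_A|\mu(A)-\nu(A)|$ denotes total variation distance. A Markov chain with stationary probability distribution $\pi$ is polynomially ergodic of order $m>0$ if there exists a function $M:\mathcal{X}\to[0,\infty)$ such that $$\|P^n(x,\cdot)-\pi(\cdot)\|\le M(x)\,n^{-m}\qquad\text{for all }x\in\mathcal{X},\ n\in\mathbb{N}=\{1,2,\dots\}.$$ The expectation $E$ is for the chain started at $X_0=x$. *)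

(* Defs.v *)
From HB Require Import structures.
From mathcomp Require Import all_boot all_order all_algebra.
From mathcomp Require Import all_classical all_reals all_analysis.

Set Implicit Arguments.
Unset Strict Implicit.
Unset Printing Implicit Defensive.

Import Order.TTheory GRing.Theory Num.Theory.
Import numFieldNormedType.Exports.

Local Open Scope classical_set_scope.
Local Open Scope ring_scope.
Local Open Scope ereal_scope.

Section markov_chain.
Context d (T : measurableType d) (R : realType).
Implicit Types (K : R.-pker T ~> T) (pi mu : probability T R) (f : T -> R).

(* K^0(x, .) is the Dirac mass at x and
   K^(n+1)(x, A) = \int K^n(x, dy) K(y, A). The library equips this composition
   with a subprobability kernel structure only, hence the type. *)
Fixpoint nstep K (n : nat) : R.-spker T ~> T :=
  if n is n'.+1 then mkcomp_noparam (nstep K n') K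
  else kdirac (@measurable_id _ T setT).

Definition stationary K pi :=
  forall A, measurable A -> \int[pi]_x K x A = pi A.

Definition tv_dist (mu nu : {measure set T -> \bar R}) : \bar R :=
  ereal_sup [set `|mu A - nu A| | A in measurable].

Definition polynomially_ergodic K pi (m : R) :=
  (0 < m)%R /\
  exists M : T -> R, (forall x, 0 <= M x)%R /\
    forall x (n : nat), (0 < n)%N ->
      tv_dist (nstep K n x) pi <= (M x * n%:R `^ (- m))%:E.

Section process.
Context d' (Omega : measurableType d') (Pr : probability Omega R).
Implicit Types X : nat -> {RV Pr >-> T}.

Definition natural_filtration X (n : nat) : set (set Omega) :=
  <<s \bigcup_(i in [set i | (i <= n)%N])
        preimage_set_system setT (X i) measurable >>.

(* The second clause says that K (X n) A is a version of the conditional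
   probability of X n.+1 \in A given the past up to time n. *)
Definition is_markov_chain K mu X :=
  (forall A, measurable A -> distribution Pr (X 0%N) A = mu A) /\
  (forall (n : nat) (A : set T) (B : set Omega),
     measurable A -> natural_filtration X n B ->
     Pr (B `&` X n.+1 @^-1` A) = \int[Pr]_(w in B) K (X n w) A).

Definition ergodic_avg f X (n : nat) (w : Omega) : R :=
  (n%:R^-1 * \sum_(1 <= i < n.+1) f (X i w))%R.

Definition bias pi f X (n : nat) : \bar R :=
  'E_Pr[ergodic_avg f X n] - \int[pi]_x (f x)%:E.

End process.
End markov_chain.

(* Main.v *)
Require Import Defs.
From HB Require Import structures.
From mathcomp Require Import all_boot all_order all_algebra.
From mathcomp Require Import lra.
From mathcomp Require Import all_classical all_reals all_analysis.
From mathcomp Require Import measurable_realfun.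

(** The bias of [e_n] is the mean, over [1 <= i <= n], of the differences
    [E f(X_i) - pi(f)].  Each difference is controlled by the distance to
    stationarity at time [i], because a function bounded by [D] cannot separate
    two laws at total variation distance [t] by more than [2 D t]
    ([dist_Rintegral_le]).  As the law of [X_i] is [P^i(x, .)]
    ([distribution_nstep]), polynomial ergodicity gives
    [|E f(X_i) - pi(f)| <= 2 D M(x) i^(-m)].

    Since [m > 1/2], this is [o(i^(-1/2))].  This rate survives averaging:
    [1^(-1/2) + ... + n^(-1/2) <= 2 n^(1/2)], so the mean of [n] terms of order
    [o(i^(-1/2))] is again [o(n^(-1/2))] ([sqrt_mean_cvg0]).
    Comparing with [i^(-1/2)] treats all exponents [m > 1/2] alike, although
    the sums of [i^(-m)] behave differently for [m < 1], [m = 1] and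
    [m > 1].

    The comparison of integrals is made on level sets.  For [0 <= g <= C], the
    integral of [g] against [P] is the integral of [P (g > r)] over
    [0 <= r <= C] ([integral_layer_cake]), and for each [r] the two
    probabilities of [g > r] differ by at most [t]. *)

Set Implicit Arguments.
Unset Strict Implicit.
Unset Printing Implicit Defensive.

Import Order.TTheory GRing.Theory Num.Theory.
Import numFieldNormedType.Exports.

Local Open Scope classical_set_scope.
Local Open Scope ring_scope.

(** * Averaging sequences of order o(n^(-1/2)) *)

Lemma powRn_cvg0 (R : realType) (p : R) : 0 < p ->
  (n%:R `^ (- p) : R) @[n --> \oo] --> (0 : R).
Proof.
move=> p0.
have h : (n%:R^-1 : R) @[n --> \oo] --> (0 : R)^'+.
  have h0 : (n%:R^-1 : R) @[n --> \oo] --> (0 : R).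
    by rewrite -cvg_shiftS; exact: cvg_harmonic.
  move=> A A0.
  have {}A0 : \forall n \near \oo, (0 < n%:R^-1 :> R) -> A (n%:R^-1).
    exact: (h0 _ A0).
  case: A0 => N _ A0; exists N.+1 => // n /= Nn.
  by apply: A0 => /=; [exact: ltnW|rewrite invr_gt0 ltr0n (leq_trans _ Nn)].
apply: cvg_trans (cvg_comp _ _ h (powR_cvg0 p0)).
apply: near_eq_cvg; near=> n => /=.
by rewrite -powR_inv1// -powRrM mulN1r.
Unshelve. all: by end_near.
Qed.


(** Beyond [N] the sum is dominated by a telescoping one, because
    [n^(-1/2) <= 2 (n^(1/2) - (n - 1)^(1/2))]. *)
Lemma sum_le_sqrt (R : realType) (a : R^nat) (c : R) (N : nat) :
  (forall n, (N < n)%N -> Num.sqrt n%:R * a n <= c) -> 0 <= c ->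
  forall n, (N <= n)%N ->
  \sum_(1 <= i < n.+1) a i <=
  \sum_(1 <= i < N.+1) a i + 2 * c * Num.sqrt n%:R.
Proof.
move=> ac c0 n; elim: n => [|n IH].
  by rewrite leqn0 => /eqP ->; rewrite sqrtr0 mulr0 addr0.
rewrite leq_eqVlt => /predU1P[->|Nn]; first
  by rewrite lerDl !mulr_ge0// sqrtr_ge0.
rewrite big_nat_recr//=.
have := IH Nn; have := ac _ Nn.
have : Num.sqrt (n.+1%:R : R) ^+ 2 = n.+1%:R by rewrite sqr_sqrtr.
have : Num.sqrt (n%:R : R) ^+ 2 = n%:R by rewrite sqr_sqrtr.
have : 0 < Num.sqrt (n.+1%:R : R) by rewrite sqrtr_gt0.
have : 0 <= Num.sqrt (n%:R : R) by rewrite sqrtr_ge0.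
rewrite -natr1; set v := Num.sqrt _; set u := Num.sqrt _ => v0 u0.
move=> vE uE H1 H2.
have H3 : a n.+1 <= 2 * c * (u - v).
  rewrite -(ler_pM2l u0) (le_trans H1)//.
  (* 2 u (u - v) = u ^ 2 - v ^ 2 + (u - v) ^ 2, and u ^ 2 - v ^ 2 = 1 *)
  have : 1 <= 2 * u * (u - v).
    have : 0 <= (u - v) ^+ 2 by exact: sqr_ge0.
    by nra.
  by nra.
by lra.
Qed.

(** A Cesaro theorem for the rate [o(n^(-1/2))].  The finitely many terms before
    [a i] falls below [(e / 4) i^(-1/2)] contribute a constant [S], which
    division by [n^(1/2)] makes negligible; [sum_le_sqrt] bounds the others by
    [(e / 2) n^(1/2)]. *)
Lemma sqrt_mean_cvg0 (R : realType) (a : R^nat) :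
  Num.sqrt n%:R * a n @[n --> \oo] --> (0 : R) ->
  (forall n, 0 <= a n) ->
  Num.sqrt n%:R * (n%:R^-1 * \sum_(1 <= i < n.+1) a i) @[n --> \oo] --> (0 : R).
Proof.
move=> ca a0; apply/cvgr0Pnorm_le => e e0.
have [|N _ aN] := cvgr0_norm_le _ ca (e / 4); first by rewrite divr_gt0.
pose S := \sum_(1 <= i < N.+1) a i.
have S0 : 0 <= S by exact: sumr_ge0.
near=> n.
have Nn : (N <= n)%N by near: n; exact: nbhs_infty_ge.
have n0 : (0 < n)%N by near: n; exact: nbhs_infty_gt.
have Sn : 2 * S / e <= Num.sqrt n%:R.
  rewrite (le_trans (ler_norm _))// -sqrtr_sqr ler_wsqrtr//.
  by near: n; exact: nbhs_infty_ger.
have bnd : \sum_(1 <= i < n.+1) a i <= S + 2 * (e / 4) * Num.sqrt n%:R.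
  apply: sum_le_sqrt Nn => [k Nk|]; last by rewrite divr_ge0// ltW.
  by rewrite (le_trans (ler_norm _))// aN//= ltnW.
set s := Num.sqrt _ in Sn bnd *.
have s0 : 0 < s by rewrite sqrtr_gt0 ltr0n.
have ns : n%:R = s ^+ 2 :> R by rewrite sqr_sqrtr.
have sum0 : 0 <= \sum_(1 <= i < n.+1) a i by exact: sumr_ge0.
rewrite ns ger0_norm; last by rewrite !mulr_ge0// ?invr_ge0 ?exprn_ge0// ltW.
rewrite expr2 invfM !mulrA mulfV ?gt_eqF// mul1r mulrC ler_pdivrMr//.
apply: (le_trans bnd); move: Sn; rewrite ler_pdivrMr// => Sn; nra.
Unshelve. all: by end_near.
Qed.

Local Open Scope ereal_scope.

(** * Total variation and integrals of bounded functions *)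

(** For a function bounded by [C], the tail probabilities vanish beyond [C], so
    the range of integration is an interval of finite length. *)
Lemma integral_layer_cake d (T : measurableType d) (R : realType)
    (P : probability T R) (g : T -> R) (C : R) :
  measurable_fun [set: T] g -> (forall x, 0 <= g x <= C)%R ->
  \int[P]_x (g x)%:E =
  \int[lebesgue_measure]_(r in `[0%R, C]) P (g @^-1` `]r, +oo[).
Proof.
move=> mg g0C.
pose Y : {RV P >-> R} := mfun_Sub (mem_set mg : g \in mfun).
have Y0 x : (0 <= Y x)%R by case/andP: (g0C x).
have := ge0_expectation_ccdf Y0; rewrite expectation_def => ->.
rewrite [LHS]integral_mkcond [RHS]integral_mkcond.
apply: eq_integral => r _; rewrite !patchE.
rewrite !mem_setE !in_itv/= andbT; case: (leP 0%R r) => //= r0.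
case: (leP r C) => // Cr.
rewrite /ccdf /distribution /= /pushforward /=.
rewrite (_ : _ @^-1` _ = set0) ?measure0//.
apply/seteqP; split=> x //=; rewrite in_itv/= andbT => /(lt_trans Cr).
by case/andP: (g0C x) => _ gC /(le_lt_trans gC); rewrite ltxx.
Qed.

(** The hypothesis is applied to the level sets of [g]; integrating the error
    [t] over an interval of length [C] gives [C * t]. *)
Lemma integral_le_addtv d (T : measurableType d) (R : realType)
    (P Q : probability T R) (g : T -> R) (C t : R) :
  measurable_fun [set: T] g -> (forall x, 0 <= g x <= C)%R ->
  (0 <= C)%R -> (0 <= t)%R ->
  (forall A, measurable A -> P A <= Q A + t%:E) ->
  \int[P]_x (g x)%:E <= \int[Q]_x (g x)%:E + (C * t)%:E.
Proof.
move=> mg g0C C0 t0 PQ.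
have mtail (P' : probability T R) :
    measurable_fun (`[0%R, C] : set R) (fun r : R => P' (g @^-1` `]r, +oo[)).
  pose Y : {RV P' >-> R} := mfun_Sub (mem_set mg : g \in mfun).
  by apply: measurable_funTS; exact: (ccdf_measurable Y).
have mitv r : measurable (g @^-1` `]r, +oo[%classic).
  by rewrite -[X in measurable X]setTI; exact: mg.
rewrite !(integral_layer_cake _ mg g0C).
have -> : (C * t)%:E = \int[@lebesgue_measure R]_(r in `[0%R, C]) t%:E.
  rewrite integral_cst//= lebesgue_measure_itv/= lte_fin oppr0 adde0.
  by case: ltgtP C0 => // [_ _|<- _]; rewrite ?EFinM 1?muleC// mule0 mulr0.
rewrite -ge0_integralD//.
- apply: ge0_le_integral => //.
  + exact: mtail.
  + by apply: emeasurable_funD; [exact: mtail|exact: measurable_cst].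
  + by move=> r _; exact: PQ.
- exact: mtail.
Qed.

Lemma integrable_bounded d (T : measurableType d) (R : realType)
    (P : probability T R) (f : T -> R) (D : R) :
  measurable_fun [set: T] f -> (forall x, `|f x| <= D)%R ->
  P.-integrable [set: T] (EFin \o f).
Proof.
move=> mf fD; apply: measurable_bounded_integrable => //.
  by rewrite [X in X < _]probability_setT ltry.
exists D; split; first exact: num_real.
by move=> M DM x _; apply: (le_trans (fD x)); exact: ltW.
Qed.

(** Adding [D] to [f] gives a function with values in [[0, 2 D]], to which
    [integral_le_addtv] applies; the added constant cancels because [P] and [Q]
    are both probabilities. *)
Lemma dist_Rintegral_le d (T : measurableType d) (R : realType)
    (P Q : probability T R) (f : T -> R) (D t : R) :
  measurable_fun [set: T] f -> (0 <= D)%R -> (forall x, `|f x| <= D)%R ->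
  (forall A, measurable A -> `|P A - Q A| <= t%:E) ->
  (`|\int[P]_x f x - \int[Q]_x f x| <= 2 * D * t)%R.
Proof.
move=> mf D0 fD PQ.
have t0 : (0 <= t)%R.
  by rewrite -lee_fin; apply: le_trans (PQ set0 measurable0); exact: abse_ge0.
pose g x := (f x + D)%R.
have mg : measurable_fun [set: T] g by exact: measurable_funD.
have gD x : (0 <= g x <= 2 * D)%R.
  by have := fD x; rewrite ler_norml /g => /andP[? ?]; apply/andP; split; lra.
have D20 : (0 <= 2 * D)%R by rewrite mulr_ge0.
have shift (P' : probability T R) :
    \int[P']_x (g x)%:E = (\int[P']_x f x + D)%:E.
  have if' := integrable_bounded P' mf fD.
  have ic : P'.-integrable [set: T] (EFin \o cst D).
    apply: (@integrable_bounded _ _ _ P' (cst D) D) => // _ /=.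
    by rewrite ger0_norm.
  rewrite -[LHS]fineK; last first.
    apply: integrable_fin_num => //.
    apply: (@integrable_bounded _ _ _ P' g (2 * D)) => // x.
    by case/andP: (gD x) => *; rewrite ger0_norm.
  congr EFin; rewrite -[LHS]/(\int[P']_x g x)%R /g RintegralD// Rintegral_cst//.
  by rewrite [X in fine X]probability_setT mulr1.
have half (P1 P2 : probability T R) :
    (forall A, measurable A -> `|P1 A - P2 A| <= t%:E) ->
    (\int[P1]_x f x - \int[P2]_x f x <= 2 * D * t)%R.
  move=> H.
  have /(_ mg gD D20 t0) := @integral_le_addtv _ _ _ P1 P2 g (2 * D) t.
  rewrite !shift -EFinD lee_fin => H'.
  suff : (\int[P1]_x f x + D <= \int[P2]_x f x + D + 2 * D * t)%R by lra.
  apply: H' => A mA; have := le_trans (lee_abs _) (H A mA).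
  by rewrite leeBlDl ?fin_num_measure.
rewrite ler_norml; apply/andP; split; last exact: half.
rewrite lerNl opprB; apply: half => A mA.
by rewrite -abseN oppeB ?fin_num_adde_defr ?fin_num_measure// addeC PQ.
Qed.

(** * Law of the chain and its bias *)

(** Taking the whole space as conditioning event in the Markov property and
    transporting the integral to the law of [X n] gives the recursion that
    defines [nstep]. *)
Lemma distribution_nstep d (T : measurableType d) (R : realType)
    (K : R.-pker T ~> T) (x : T) d' (Omega : measurableType d')
    (Pr : probability Omega R) (X : nat -> {RV Pr >-> T}) :
  is_markov_chain K (\d_x) X ->
  forall n A, measurable A -> distribution Pr (X n) A = nstep K n x A.
Proof.
move=> [X0 XS]; elim=> [|n IH] A mA; first by rewrite X0.
rewrite -[LHS]/(Pr (X n.+1 @^-1` A)) -[X in Pr X]setTI XS//; last first.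
  exact: (@measurableT _ (g_sigma_algebraType _)).
rewrite -[LHS]/(\int[Pr]_w ((fun y => K y A) \o X n) w).
rewrite -ge0_integral_distribution//; last exact: measurable_kernel.
by apply: eq_measure_integral => B mB _; exact: IH.
Qed.

(** The integrals of [f] are finite, so the bias is a real number and the
    centring constant [pi(f)] can be distributed over the mean. *)
Lemma biasE d (T : measurableType d) (R : realType) (pi : probability T R)
    (f : T -> R) (D : R) d' (Omega : measurableType d')
    (Pr : probability Omega R) (X : nat -> {RV Pr >-> T}) (n : nat) :
  measurable_fun [set: T] f -> (forall x, `|f x| <= D)%R -> (0 < n)%N ->
  bias pi f X n = (n%:R^-1 * \sum_(1 <= i < n.+1)
    (\int[distribution Pr (X i)]_y f y - \int[pi]_y f y))%R%:E.
Proof.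
move=> mf fD n0.
have ifX i : Pr.-integrable [set: Omega] (EFin \o (f \o X i)).
  apply: (@integrable_bounded _ _ _ Pr _ D) => [|w /=]; last exact: fD.
  exact: measurableT_comp.
have EfX i : \int[Pr]_w (f (X i w))%:E =
    (\int[distribution Pr (X i)]_y f y)%R%:E.
  rewrite fineK; last first.
    by apply: integrable_fin_num => //; exact: integrable_bounded fD.
  by rewrite integral_distribution//; [exact/measurable_EFinP|exact: ifX].
have Epi : \int[pi]_y (f y)%:E = (\int[pi]_y f y)%R%:E.
  rewrite fineK//.
  by apply: integrable_fin_num => //; exact: integrable_bounded fD.
rewrite /bias unlock Epi /ergodic_avg.
under eq_integral do rewrite EFinM -sumEFin.
rewrite integralZl//; last first.
  by apply: integrable_sum => // i _; exact: ifX.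
rewrite integral_sum//; under eq_bigr do rewrite EfX.
rewrite sumEFin -EFinM -EFinB; congr EFin.
rewrite sumrB mulrBr; congr (_ - _)%R.
rewrite sumr_const_nat subn1 /= -[X in (_ * X)%R]mulr_natl mulrA.
by rewrite mulVf ?mul1r// pnatr_eq0 -lt0n.
Qed.

(** Multiplying the bound [2 D M(x) n^(-m)] by [n^s] leaves the negative
    power [n^(s - m)]. *)
Lemma cvg_pow_Rintegral_dist d (T : measurableType d) (R : realType)
    (K : R.-pker T ~> T) (pi : probability T R) (m s : R)
    (f : T -> R) (D : R) (x : T) (mu : nat -> probability T R) :
  (s < m)%R -> polynomially_ergodic K pi m ->
  measurable_fun [set: T] f -> (0 <= D)%R -> (forall x, `|f x| <= D)%R ->
  (forall n A, measurable A -> mu n A = nstep K n x A) ->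
  (n%:R `^ s * `|\int[mu n]_y f y - \int[pi]_y f y|)%R @[n --> \oo]
    --> (0 : R)%R.
Proof.
move=> sm [_ [M [M0 HM]]] mf D0 fD muE.
have cvgC : (2 * D * M x * n%:R `^ (- (m - s)) : R)%R @[n --> \oo]
    --> (0 : R)%R.
  rewrite -(mulr0 (2 * D * M x)%R).
  by apply: cvgMr; apply: powRn_cvg0; rewrite subr_gt0.
apply: (squeeze_cvgr _ (cvg_cst (0 : R)%R) cvgC).
near=> n.
have n0 : (0 < n)%N by near: n; exact: nbhs_infty_gt.
rewrite mulr_ge0 ?powR_ge0//=.
rewrite opprB powRD ?pnatr_eq0 -?lt0n ?n0 ?implybT//.
rewrite [leRHS]mulrCA ler_wpM2l ?powR_ge0// -[leRHS]mulrA.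
apply: dist_Rintegral_le => // A mA.
apply: le_trans (HM x n n0); apply: ereal_sup_ubound.
by exists A => //; rewrite muE.
Unshelve. all: by end_near.
Qed.

Theorem theorem4 (R : realType) (d : measure_display) (T : measurableType d)
    (K : R.-pker T ~> T) (pi : probability T R) (m : R)
    (f : T -> R) (D : R) :
  stationary K pi ->
  (2^-1 < m)%R ->
  polynomially_ergodic K pi m ->
  measurable_fun [set: T] f ->
  (0 <= D)%R ->
  (forall x : T, `|f x| <= D)%R ->
  forall (x : T) (d' : measure_display) (Omega : measurableType d')
    (Pr : probability Omega R) (X : nat -> {RV Pr >-> T}),
  is_markov_chain K (\d_x) X ->
  (n%:R `^ 2^-1)%:E * `|bias pi f X n| @[n --> \oo] --> 0.
Proof.
move=> _ m2 ergo mf D0 fD x d' Omega Pr X MX.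
pose a n := `|\int[distribution Pr (X n)]_y f y - \int[pi]_y f y|%R.
have a0 : (Num.sqrt n%:R * a n)%R @[n --> \oo] --> (0 : R)%R.
  under eq_cvg do rewrite -powR12_sqrt//.
  exact: (cvg_pow_Rintegral_dist m2 ergo mf D0 fD (distribution_nstep MX)).
have mean0 := sqrt_mean_cvg0 a0 (fun=> normr_ge0 _).
have {}mean0 : (Num.sqrt n%:R * (n%:R^-1 * \sum_(1 <= i < n.+1) a i))%:E
    @[n --> \oo] --> 0.
  by apply: cvg_EFin mean0; exact: nearW.
apply: (squeeze_cvge _ (cvg_cst 0) mean0).
near=> n.
have n0 : (0 < n)%N by near: n; exact: nbhs_infty_gt.
rewrite mule_ge0 ?lee_fin ?powR_ge0//=.
rewrite (biasE _ _ mf fD n0) abse_EFin -EFinM lee_fin powR12_sqrt//.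
rewrite ler_wpM2l ?sqrtr_ge0// normrM ger0_norm ?invr_ge0//.
by rewrite ler_wpM2l ?invr_ge0// ler_norm_sum.
Unshelve. all: by end_near.
Qed.
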